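(* There exists a universal constant $C>1$ such that for every $N\ge1$ and every non-zero linear map $T:M(N)\to M(N)$ there exist non-zero orthogonal projections $P,Q\in M(N)$ with $$\frac{\|T\|_{2\to2}}{C\log(h(T)+1)}<\frac{|\langle T(P),Q\rangle_{\mathrm{HS}}|}{\sqrt{\operatorname{tr}(P)\operatorname{tr}(Q)}}\le\|T\|_{2\to2}.$$
   Context: $M(N)$ is the space of $N\times N$ complex matrices with Hilbert–Schmidt inner product $\langle A,B\rangle_{\mathrm{HS}}=\operatorname{tr}(A^*B)$. $\|A\|_p$ is the Schatten-$p$ norm for $1\le p<\infty$ and $\|A\|_\infty$ the operator norm; $\|T\|_{p\to p}=\sup_{X\ne0}\|T(X)\|_p/\|X\|_p$. The height of a non-zero linear map is $h(T)=\sqrt{\|T\|_{1\to1}\|T\|_{\infty\to\infty}}/\|T\|_{2\to2}$. *)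

(* Defs.v *)
From HB Require Import structures.
From mathcomp Require Import all_boot all_order all_algebra.
From mathcomp Require Import spectral.
From mathcomp Require Import complex.
From mathcomp Require Import all_classical all_reals all_analysis.
Set Implicit Arguments. Unset Strict Implicit. Unset Printing Implicit Defensive.
Import Order.TTheory GRing.Theory Num.Theory.
Local Open Scope ring_scope.
Local Open Scope classical_set_scope.

Definition adjmx (R : realType) (N : nat) (A : 'M[R[i]]_N) : 'M[R[i]]_N :=
  \matrix_(i, j) (A j i)^*.

(* Singular values of A: square roots of the eigenvalues of A^* A,
   the eigenvalues of the (normal) matrix A^* A being read off its spectral
   decomposition (spectral_diag).  They are nonnegative reals; we return
   them as elements of R. *)
Definition singval (R : realType) (N : nat) (A : 'M[R[i]]_N) (i : 'I_N) : R :=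
  complex.Re (sqrtC (spectral_diag (adjmx A *m A) 0 i)).

Definition schatten1 (R : realType) (N : nat) (A : 'M[R[i]]_N) : R :=
  \sum_i singval A i.
Definition schatten2 (R : realType) (N : nat) (A : 'M[R[i]]_N) : R :=
  Num.sqrt (\sum_i singval A i ^+ 2).
Definition schatten_inf (R : realType) (N : nat) (A : 'M[R[i]]_N) : R :=
  \big[Num.max/0]_i singval A i.

Definition opnorm (R : realType) (N : nat) (nrm : 'M[R[i]]_N -> R)
  (T : 'M[R[i]]_N -> 'M[R[i]]_N) : R :=
  sup [set r : R | exists X : 'M[R[i]]_N, X != 0 /\ r = nrm (T X) / nrm X].

Definition norm11 (R : realType) (N : nat) (T : 'M[R[i]]_N -> 'M[R[i]]_N) : R :=
  opnorm (@schatten1 R N) T.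
Definition norm22 (R : realType) (N : nat) (T : 'M[R[i]]_N -> 'M[R[i]]_N) : R :=
  opnorm (@schatten2 R N) T.
Definition norminfinf (R : realType) (N : nat) (T : 'M[R[i]]_N -> 'M[R[i]]_N) : R :=
  opnorm (@schatten_inf R N) T.

Definition height (R : realType) (N : nat) (T : 'M[R[i]]_N -> 'M[R[i]]_N) : R :=
  Num.sqrt (norm11 T * norminfinf T) / norm22 T.

Definition hs (R : realType) (N : nat) (A B : 'M[R[i]]_N) : R[i] :=
  \tr (adjmx A *m B).

Definition nz_orth_proj (R : realType) (N : nat) (P : 'M[R[i]]_N) : Prop :=
  [/\ P *m P = P, adjmx P = P & P != 0].

(* Main.v *)
Require Import Defs.
From HB Require Import structures.
From mathcomp Require Import all_boot all_order all_algebra.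
From mathcomp Require Import spectral.
From mathcomp Require Import complex.
From mathcomp Require Import all_classical all_reals all_analysis.
From mathcomp Require Import ring lra zify.
Set Implicit Arguments. Unset Strict Implicit. Unset Printing Implicit Defensive.
Import Order.TTheory GRing.Theory Num.Theory.
Local Open Scope ring_scope.

(** Let A = ||T||_{1->1} and B = ||T||_{oo->oo}.  For Hermitian X = sum_i x_i p_i and
    Y = sum_j y_j q_j with rank-one spectral projections p_i, q_j, the pairing <T X, Y> is the
    bilinear form of the matrix m_ij = <T p_i, q_j>.  Testing T on p_i against the unitaries
    sum_j +-q_j, and on sum_i +-p_i against q_j, shows that the absolute row sums of m are at
    most A and its absolute column sums at most B.  If d bounds |<T P, Q>| / sqrt(tr P tr Q)
    for all projections, then the sum of m over any rectangle S x S' is at most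
    d sqrt(|S| |S'|).

    For nonnegative unit vectors x, y, sort the indices by dyadic size relative to scales
    in the ratio sqrt A : sqrt B.  Pairs of indices whose levels differ by more than n
    contribute at most 2 sqrt(AB) / 2^n by the row and column bounds.  On a block of levels
    (k, l) the form is largest at a vertex of the cube, hence controlled by d; summing over
    |k - l| <= n costs a factor 2n + 1.  Splitting general X and Y into Hermitian and then
    positive parts gives ||T|| <= 64 h / 2^n ||T|| + 128 d (2n + 1), and 2^n is taken
    comparable to 128 h.  Since the Schur test gives h >= 1/8, n is O(log (h + 1)). *)

(** * Real bilinear forms *)

Section RealForms.
Variable R : realType.

Lemma sum_mul_sqr_le (I : finType) (a b : I -> R) :
  (\sum_i a i * b i) ^+ 2 <= (\sum_i a i ^+ 2) * (\sum_i b i ^+ 2).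
Proof.
set p := \sum_i a i * b i; set u := \sum_i a i ^+ 2; set v := \sum_i b i ^+ 2.
have u0 : 0 <= u by apply: sumr_ge0 => i _; rewrite sqr_ge0.
have [u_eq0|u_neq0] := eqVneq u 0.
  have a0 i : a i = 0.
    by apply/eqP; rewrite -sqrf_eq0; apply/eqP;
      move/psumr_eq0P: u_eq0; apply => // j _; rewrite sqr_ge0.
  by rewrite /p big1 ?expr0n ?mulr_ge0 ?sumr_ge0 // => i _; rewrite ?sqr_ge0 // a0 mul0r.
have u_gt0 : 0 < u by rewrite lt_def u_neq0.
have : 0 <= \sum_i (u * b i - p * a i) ^+ 2 by apply: sumr_ge0 => i _; rewrite sqr_ge0.
have -> : \sum_i (u * b i - p * a i) ^+ 2 = u * (u * v - p ^+ 2).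
  have expand s t : \sum_i (s * b i - t * a i) ^+ 2 = s ^+ 2 * v - 2 * s * t * p + t ^+ 2 * u.
    by rewrite !mulr_sumr -sumrB -big_split /=; apply: eq_bigr => i _; ring.
  by rewrite expand; ring.
by rewrite pmulr_rge0 // subr_ge0.
Qed.

Lemma sum_mul_le (I : finType) (a b : I -> R) :
  \sum_i a i * b i <= Num.sqrt (\sum_i a i ^+ 2) * Num.sqrt (\sum_i b i ^+ 2).
Proof.
rewrite -sqrtrM; last by apply: sumr_ge0 => i _; exact: sqr_ge0.
by rewrite (le_trans (ler_norm _)) // -sqrtr_sqr ler_wsqrtr // sum_mul_sqr_le.
Qed.

Variables (I J : finType) (m : I -> J -> R).

Definition rows_bounded (A : R) := forall i, \sum_j `|m i j| <= A.
Definition cols_bounded (B : R) := forall j, \sum_i `|m i j| <= B.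
(** One-sided: a bound on absolute values is expressed by imposing it on [m] and on its negative. *)
Definition cut_bounded (d : R) := forall (S : {set I}) (S' : {set J}),
  \sum_(i in S) \sum_(j in S') m i j <= d * Num.sqrt (#|S|%:R * #|S'|%:R).

(** Weighted AM-GM, with weights [b / a] and [a / b] chosen so that the row part and the column part
    each contribute half of [Num.sqrt (A * B)]. *)
Lemma schur_test A B (x : I -> R) (y : J -> R) : 0 < A -> 0 < B ->
  rows_bounded A -> cols_bounded B ->
  \sum_i x i ^+ 2 <= 1 -> \sum_j y j ^+ 2 <= 1 ->
  \sum_i \sum_j x i * y j * m i j <= Num.sqrt (A * B).
Proof.
move=> A0 B0 hA hB hx hy.
set a := Num.sqrt A; set b := Num.sqrt B.
have a0 : 0 < a by rewrite sqrtr_gt0.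
have b0 : 0 < b by rewrite sqrtr_gt0.
have a2 : a ^+ 2 = A by rewrite sqr_sqrtr ?ltW.
have b2 : b ^+ 2 = B by rewrite sqr_sqrtr ?ltW.
have key i j : x i * y j * m i j <=
    2^-1 * (b / a) * (x i ^+ 2 * `|m i j|) + 2^-1 * (a / b) * (y j ^+ 2 * `|m i j|).
  apply: (le_trans (ler_norm _)); rewrite normrM.
  have -> : 2^-1 * (b / a) * (x i ^+ 2 * `|m i j|) +
            2^-1 * (a / b) * (y j ^+ 2 * `|m i j|) =
         (2^-1 * ((b / a) * x i ^+ 2 + (a / b) * y j ^+ 2)) * `|m i j| by ring.
  rewrite ler_wpM2r // -subr_ge0.
  have -> : 2^-1 * (b / a * x i ^+ 2 + a / b * y j ^+ 2) - `|x i * y j| =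
     2^-1 * (a * b)^-1 * (b * `|x i| - a * `|y j|) ^+ 2.
    rewrite sqrrB !exprMn !real_normK ?num_real // normrM.
    by field; rewrite ?gt_eqF.
  by rewrite mulr_ge0 ?sqr_ge0 // mulr_ge0 // invr_ge0 ?mulr_ge0 ?ltW.
apply: (le_trans (ler_sum _ (fun i _ => ler_sum _ (fun j _ => key i j)))).
under eq_bigr do rewrite big_split /= -!mulr_sumr.
rewrite big_split /= -!mulr_sumr [X in _ + _ * X]exchange_big /=.
under [X in _ + _ * X]eq_bigr do rewrite -mulr_sumr.
have -> : Num.sqrt (A * B) = 2^-1 * (b / a) * A + 2^-1 * (a / b) * B.
  rewrite sqrtrM ?ltW // -/a -/b -a2 -b2; field; by rewrite ?gt_eqF.
apply: lerD; rewrite ler_wpM2l ?mulr_ge0 ?invr_ge0 ?(ltW a0) ?(ltW b0) //.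
  apply: (@le_trans _ _ (\sum_i x i ^+ 2 * A)).
    by apply: ler_sum => i _; rewrite ler_wpM2l ?sqr_ge0.
  by rewrite -mulr_suml ler_piMl // ltW.
apply: (@le_trans _ _ (\sum_i y i ^+ 2 * B)).
  by apply: ler_sum => i _; rewrite ler_wpM2l ?sqr_ge0.
by rewrite -mulr_suml ler_piMl // ltW.
Qed.

(** The form is linear in each argument, so replacing first [a], then [b], by the indicator of the
    indices with positive coefficient does not decrease it. The sets so obtained lie inside [S] and
    [S'], and the bound is monotone in both cardinalities. *)
Lemma cut_bounded_cube d (a : I -> R) (b : J -> R) (S : {set I}) (S' : {set J}) :
  0 <= d -> cut_bounded d ->
  (forall i, i \in S -> 0 <= a i <= 1) -> (forall j, j \in S' -> 0 <= b j <= 1) ->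
  \sum_(i in S) \sum_(j in S') a i * b j * m i j <= d * Num.sqrt (#|S|%:R * #|S'|%:R).
Proof.
move=> d0 hd ha hb.
have vertex (K : finType) (U : {set K}) (c e : K -> R) :
    (forall k, k \in U -> 0 <= c k <= 1) ->
    \sum_(k in U) c k * e k <= \sum_(k in [set k in U | 0 < e k]) e k.
  move=> hc; rewrite [X in _ <= X](eq_bigl (fun k => (k \in U) && (0 < e k))); last first.
    by move=> k; rewrite inE.
  rewrite [X in X <= _](bigID (fun k => 0 < e k)) /= -[X in _ <= X]addr0 lerD //.
    apply: ler_sum => k /andP[/hc /andP[_ c1] e0].
    by rewrite ler_piMl // ltW.
  rewrite -oppr_ge0 -sumrN sumr_ge0 // => k /andP[/hc /andP[c0 _]].
  by rewrite -leNgt oppr_ge0 => e0; rewrite mulr_ge0_le0.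
under eq_bigr do under eq_bigr do rewrite -mulrA.
under eq_bigr do rewrite -mulr_sumr.
apply: (le_trans (vertex _ _ _ _ ha)); rewrite exchange_big /=.
under eq_bigr do rewrite -mulr_sumr.
apply: (le_trans (vertex _ _ _ _ hb)); rewrite exchange_big /=.
apply: (le_trans (hd _ _)); rewrite ler_wpM2l // ler_wsqrtr // ler_pM // ler_nat;
  by apply: subset_leq_card; apply/fintype.subsetP => k; rewrite inE => /andP[].
Qed.

Definition close (n k l : nat) := (k <= l + n)%N && (l <= k + n)%N.

Lemma closeC n k l : close n k l = close n l k.
Proof. exact: andbC. Qed.

(** With [not_close_gt], cuts the complement of [close] into its two one-sided ranges, in the shape
    in which [bigID] produces them. *)
Lemma not_close_lt n k l : ~~ close n k l && ~~ (k <= l + n)%N = ~~ (k <= l + n)%N.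
Proof. by rewrite /close; lia. Qed.

Lemma not_close_gt n k l : ~~ close n k l && ~~ ~~ (k <= l + n)%N = ~~ (l <= k + n)%N.
Proof. by rewrite /close; lia. Qed.

Lemma card_close L n (k : nat) : (#|[pred l : 'I_L | close n k l]| <= (2 * n).+1)%N.
Proof.
rewrite cardE -(size_map val) -(size_iota (k - n) (2 * n).+1).
apply: uniq_leq_size; first by rewrite map_inj_uniq ?enum_uniq //; exact: val_inj.
move=> v /mapP[l]; rewrite mem_enum inE /close => h ->.
rewrite mem_iota /=; move: h; move: (nat_of_ord l) => {}l; lia.
Qed.

Lemma sum_close_le L n (e : 'I_L -> R) : (forall k, 0 <= e k) ->
  \sum_(k < L) \sum_(l : 'I_L | close n k l) e k <= (2 * n).+1%:R * \sum_k e k.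
Proof.
move=> e0; rewrite mulr_sumr; apply: ler_sum => k _.
by rewrite sumr_const -[X in X <= _]mulr_natl ler_wpM2r // ler_nat card_close.
Qed.

(** * Dyadic levels at the scales [mu] and [nu] *)

Section Dyadic.
Variables (L : nat) (mu nu : R) (x : I -> R) (y : J -> R) (k : I -> 'I_L) (l : J -> 'I_L).
Hypotheses (mu0 : 0 < mu) (nu0 : 0 < nu).
Hypotheses (x0 : forall i, 0 <= x i) (y0 : forall j, 0 <= y j).
Hypothesis hk : forall i, 0 < x i -> mu * 2 ^+ k i <= x i < mu * 2 ^+ (k i).+1.
Hypothesis hl : forall j, 0 < y j -> nu * 2 ^+ l j <= y j < nu * 2 ^+ (l j).+1.
Hypotheses (hx : \sum_i x i ^+ 2 <= 1) (hy : \sum_j y j ^+ 2 <= 1).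

(** [c * 2 ^+ t] bounds the positive entries of level [t] from below, so each summand is at most the
    square mass on its level, and the levels partition the indices. *)
Lemma level_mass (K : finType) (z : K -> R) (c : R) (r : K -> 'I_L) : 0 < c ->
  (forall i, 0 < z i -> c * 2 ^+ r i <= z i) -> \sum_i z i ^+ 2 <= 1 ->
  \sum_t (c * 2 ^+ (t : 'I_L) * Num.sqrt #|[set i | (0 < z i) && (r i == t)]|%:R) ^+ 2 <= 1.
Proof.
move=> c0 hr; apply: le_trans.
rewrite [X in _ <= X](partition_big r predT) //=; apply: ler_sum => t _.
rewrite exprMn sqr_sqrtr // mulr_natr -sumr_const.
rewrite [X in _ <= X](bigID (fun i => 0 < z i)) /= -[X in X <= _]addr0 lerD //;
  last by rewrite sumr_ge0 // => i _; rewrite sqr_ge0.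
rewrite (eq_bigl (fun i => (r i == t) && (0 < z i))); last by move=> i; rewrite inE andbC.
apply: ler_sum => i /andP[/eqP <- zi]; have := hr _ zi.
by rewrite ler_sqr // nnegrE ?mulr_ge0 ?exprn_ge0 // ltW.
Qed.

(** On this range [(l j).+1 + n <= k i], so for positive entries [y j < nu * 2 ^+ (l j).+1 <= nu /
    mu / 2 ^+ n * x i]. Thus [x i * y j] is dominated by a multiple of [x i ^+ 2], and the row bound
    sums out [j]. *)
Lemma far_le (n : nat) A : 0 <= A -> rows_bounded A ->
  \sum_i \sum_(j | ~~ (k i <= l j + n)%N) x i * y j * m i j <= nu / mu / 2 ^+ n * A.
Proof.
move=> A0 hA.
have c0 : 0 <= nu / mu / 2 ^+ n by rewrite !mulr_ge0 ?invr_ge0 ?exprn_ge0 ?ltW.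
apply: (@le_trans _ _ (\sum_i nu / mu / 2 ^+ n * (x i ^+ 2 * A))); last first.
  by rewrite -mulr_sumr -mulr_suml ler_wpM2l // ler_piMl.
apply: ler_sum => i _.
apply: (@le_trans _ _ (\sum_j nu / mu / 2 ^+ n * (x i ^+ 2 * `|m i j|))); last first.
  by rewrite -!mulr_sumr ler_wpM2l // ler_wpM2l ?sqr_ge0.
rewrite big_mkcond /=; apply: ler_sum => j _; case: ifP => [|_]; last first.
  by rewrite mulr_ge0 // mulr_ge0 ?sqr_ge0.
rewrite -ltnNge => kl.
apply: (@le_trans _ _ (x i * y j * `|m i j|)); first by rewrite ler_wpM2l ?mulr_ge0 // ler_norm.
rewrite mulrA ler_wpM2r // expr2.
have := x0 i; rewrite le_eqVlt => /predU1P[<-|xi]; first by rewrite !mul0r mulr0.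
have := y0 j; rewrite le_eqVlt => /predU1P[<-|yj].
  by rewrite mulr0 mulr_ge0 // mulr_ge0 // ltW.
rewrite [X in _ <= X](_ : _ = x i * (nu / mu / 2 ^+ n * x i)); last by ring.
rewrite ler_pM2l //.
have /andP[_ /ltW /le_trans] := hl yj; apply.
have /andP[xl _] := hk xi.
apply: (@le_trans _ _ (nu / mu / 2 ^+ n * (mu * 2 ^+ k i))); last by rewrite ler_wpM2l.
rewrite [X in _ <= X](_ : _ = nu * (2 ^+ k i / 2 ^+ n)); last by field; rewrite ?gt_eqF ?exprn_gt0.
rewrite ler_pM2l // ler_pdivlMr ?exprn_gt0 // -exprD.
by rewrite ler_weXn2l // ?ler1n //; lia.
Qed.

Lemma near_le n d : 0 <= d -> cut_bounded d ->
  \sum_i \sum_(j | close n (k i) (l j)) x i * y j * m i j <= 4 * d * (2 * n).+1%:R.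
Proof.
move=> d0 hd.
pose X t := [set i | (0 < x i) && (k i == t)].
pose Y t := [set j | (0 < y j) && (l j == t)].
pose a (t : 'I_L) := mu * 2 ^+ t * Num.sqrt #|X t|%:R.
pose b (t : 'I_L) := nu * 2 ^+ t * Num.sqrt #|Y t|%:R.
have -> : \sum_i \sum_(j | close n (k i) (l j)) x i * y j * m i j =
    \sum_(t < L) \sum_(u : 'I_L | close n t u) \sum_(i in X t) \sum_(j in Y u) x i * y j * m i j.
  rewrite (partition_big k predT) //=; apply: eq_bigr => t _.
  rewrite [RHS]exchange_big /=.
  rewrite (bigID (fun i => 0 < x i)) /= [X in _ + X]big1 ?addr0; last first.
    move=> i /andP[_ ]; rewrite lt_def x0 andbT negbK => /eqP ->.
    by apply: big1 => j _; rewrite !mul0r.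
  apply: eq_big => [i|i /andP[/eqP -> _]]; first by rewrite inE andbC.
  rewrite (partition_big l (fun u => close n t u)) //=; apply: eq_bigr => u tu.
  rewrite (bigID (fun j => 0 < y j)) /= [X in _ + X]big1 ?addr0; last first.
    move=> j /andP[_ ]; rewrite lt_def y0 andbT negbK => /eqP ->.
    by rewrite mulr0 mul0r.
  by apply: eq_bigl => j; rewrite inE; have [->|] := eqVneq; rewrite ?andbT ?andbF ?tu.
apply: (@le_trans _ _ (\sum_(t < L) \sum_(u : 'I_L | close n t u)
   (2 * d * a t ^+ 2 + 2 * d * b u ^+ 2))).
  apply: ler_sum => t _; apply: ler_sum => u _.
  (* AM-GM decouples the two levels; what remains is to count the levels close to a given one. *)
  apply: (@le_trans _ _ (4 * d * (a t * b u))); last first.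
    rewrite -subr_ge0 [X in 0 <= X](_ : _ = 2 * d * (a t - b u) ^+ 2); last by ring.
    by rewrite mulr_ge0 ?sqr_ge0 // mulr_ge0.
  (* Dividing by the upper ends of the levels puts the entries in [[0, 1]]. The product of the upper
     ends is four times that of the lower ends, whence the factor 4. *)
  set p := mu * 2 ^+ t.+1; set q := nu * 2 ^+ u.+1.
  have p0 : 0 < p by rewrite mulr_gt0 ?exprn_gt0.
  have q0 : 0 < q by rewrite mulr_gt0 ?exprn_gt0.
  have -> : 4 * d * (a t * b u) = p * q * (d * Num.sqrt (#|X t|%:R * #|Y u|%:R)).
    by rewrite sqrtrM // /a /b /p /q !exprS; ring.
  have -> : \sum_(i in X t) \sum_(j in Y u) x i * y j * m i j =
     p * q * \sum_(i in X t) \sum_(j in Y u) (x i / p) * (y j / q) * m i j.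
    rewrite mulr_sumr; apply: eq_bigr => i _; rewrite mulr_sumr; apply: eq_bigr => j _.
    by field; rewrite ?gt_eqF.
  rewrite (ler_wpM2l (mulr_ge0 (ltW p0) (ltW q0))) //.
  apply: (@cut_bounded_cube d (fun i => x i / p) (fun j => y j / q)) => // [i|j].
    rewrite inE => /andP[/hk/andP[_ /ltW xi] /eqP kt].
    by rewrite divr_ge0 ?(ltW p0) //= ler_pdivrMr // mul1r /p -kt.
  rewrite inE => /andP[/hl/andP[_ /ltW xi] /eqP kt].
  by rewrite divr_ge0 ?(ltW q0) //= ler_pdivrMr // mul1r /q -kt.
have a1 : \sum_t a t ^+ 2 <= 1 by apply: level_mass => // i /hk /andP[].
have b1 : \sum_t b t ^+ 2 <= 1 by apply: level_mass => // i /hl /andP[].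
under eq_bigr do rewrite big_split /=.
rewrite big_split /= [X in _ + X](exchange_big_dep predT) //=.
under [X in _ + X]eq_bigr do under eq_bigl do rewrite closeC.
have d2 : 0 <= 2 * d by rewrite mulr_ge0.
have e0 (c : 'I_L -> R) t : 0 <= 2 * d * c t ^+ 2 by rewrite mulr_ge0 ?sqr_ge0.
apply: (le_trans (lerD (sum_close_le n (e0 a)) (sum_close_le n (e0 b)))).
rewrite -!mulr_sumr.
have n0 : 0 <= (2 * n).+1%:R :> R by [].
have -> : 4 * d * (2 * n).+1%:R = (2 * n).+1%:R * (2 * d * 1) + (2 * n).+1%:R * (2 * d * 1) by ring.
by rewrite lerD // ler_wpM2l // ler_wpM2l.
Qed.

End Dyadic.

End RealForms.

(** * Bounds for non-negative and then signed vectors *)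

Section RealFormBound.
Variable R : realType.

(** The exponent is the integer base-2 logarithm of the integer part of [z / c]; taking the integer
    part is harmless because the powers of 2 compared with it are integers. *)
Lemma dyadic_level (c z : R) : 0 < c -> c <= z ->
  exists k : nat, c * 2 ^+ k <= z < c * 2 ^+ k.+1.
Proof.
move=> c0 cz; set t := Num.truncn (z / c).
have zc : 1 <= z / c by rewrite ler_pdivlMr // mul1r.
have t0 : (0 < t)%N by rewrite truncn_gt0.
have /andP[tl tr] : t%:R <= z / c < t.+1%:R by apply: truncn_itv; rewrite (le_trans _ zc).
have /andP[kl kr] := trunc_log_bounds (isT : 1 < 2)%N t0.
exists (trunc_log 2 t); apply/andP; split.
  by rewrite mulrC -ler_pdivlMr // (le_trans _ tl) // -natrX ler_nat.
by rewrite mulrC -ltr_pdivrMr // (lt_le_trans tr) // -natrX ler_nat.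
Qed.

Lemma pos_lower_bound (I : finType) (z : I -> R) :
  exists2 c : R, 0 < c & forall i, 0 < z i -> c <= z i.
Proof.
(* The default 1 keeps the minimum positive when no entry is. *)
exists (\big[Order.min/1]_(i | 0 < z i) z i).
  by apply: lt_bigmin.
by move=> i zi; apply: bigmin_inf zi _.
Qed.

Lemma pos_form_le (I J : finType) (m : I -> J -> R) (A B d : R) (n : nat)
    (x : I -> R) (y : J -> R) :
  0 < A -> 0 < B -> 0 <= d ->
  rows_bounded m A -> cols_bounded m B -> cut_bounded m d ->
  (forall i, 0 <= x i) -> (forall j, 0 <= y j) ->
  \sum_i x i ^+ 2 <= 1 -> \sum_j y j ^+ 2 <= 1 ->
  \sum_i \sum_j x i * y j * m i j
    <= 2 * Num.sqrt (A * B) / 2 ^+ n + 4 * d * (2 * n).+1%:R.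
Proof.
move=> A0 B0 d0 hA hB hd x0 y0 hx hy.
set a := Num.sqrt A; set b := Num.sqrt B.
have a0 : 0 < a by rewrite sqrtr_gt0.
have b0 : 0 < b by rewrite sqrtr_gt0.
have [c1 c10 hc1] := pos_lower_bound x.
have [c2 c20 hc2] := pos_lower_bound y.
(* [s] is small enough that every positive [x i] is at least [s * a] and every positive [y j] at
   least [s * b], so all levels are natural numbers. *)
pose s := Num.min (c1 / a) (c2 / b).
have s0 : 0 < s by rewrite lt_min !divr_gt0.
(* The scales are balanced so that both off-diagonal parts cost [sqrt (A * B)]. *)
pose mu := s * a; pose nu := s * b.
have mu0 : 0 < mu by rewrite mulr_gt0.
have nu0 : 0 < nu by rewrite mulr_gt0.
have muc : mu <= c1 by rewrite /mu -ler_pdivlMr // ge_min lexx.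
have nuc : nu <= c2 by rewrite /nu -ler_pdivlMr // ge_min lexx orbT.
have /fin_all_exists[k hk] i : exists k, 0 < x i -> mu * 2 ^+ k <= x i < mu * 2 ^+ k.+1.
  have [xi|] := boolP (0 < x i); last by exists 0%N.
  by have [k hk] := dyadic_level mu0 (le_trans muc (hc1 _ xi)); exists k.
have /fin_all_exists[l hl] j : exists l, 0 < y j -> nu * 2 ^+ l <= y j < nu * 2 ^+ l.+1.
  have [yj|] := boolP (0 < y j); last by exists 0%N.
  by have [l hl] := dyadic_level nu0 (le_trans nuc (hc2 _ yj)); exists l.
pose L := (\max_i k i + \max_j l j)%N.
pose k' i : 'I_L.+1 := inord (k i); pose l' j : 'I_L.+1 := inord (l j).
have k'E i : k' i = k i :> nat.
  by rewrite inordK // ltnS (leq_trans (leq_bigmax i)) // leq_addr.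
have l'E j : l' j = l j :> nat.
  by rewrite inordK // ltnS (leq_trans (leq_bigmax j)) // leq_addl.
have {}hk i : 0 < x i -> mu * 2 ^+ k' i <= x i < mu * 2 ^+ (k' i).+1 by rewrite k'E; exact: hk.
have {}hl j : 0 < y j -> nu * 2 ^+ l' j <= y j < nu * 2 ^+ (l' j).+1 by rewrite l'E; exact: hl.
have near := near_le mu0 nu0 x0 y0 hk hl hx hy n d0 hd.
have far1 := far_le mu0 nu0 x0 y0 hk hl hx n (ltW A0) hA.
(* The opposite far range is the same estimate for the transposed matrix with the scales
   exchanged. *)
have far2 := far_le (m := fun j i => m i j) nu0 mu0 y0 x0 hl hk hy n (ltW B0) hB.
have -> : 2 * Num.sqrt (A * B) / 2 ^+ n = nu / mu / 2 ^+ n * A + mu / nu / 2 ^+ n * B.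
  have -> : A = a ^+ 2 by rewrite sqr_sqrtr ?ltW.
  have -> : B = b ^+ 2 by rewrite sqr_sqrtr ?ltW.
  rewrite sqrtrM ?sqr_ge0 // !sqrtr_sqr !gtr0_norm // /mu /nu.
  by field; rewrite ?gt_eqF ?exprn_gt0.
rewrite addrC; apply: le_trans (lerD near (lerD far1 far2)).
rewrite [X in _ + (_ + X)](exchange_big_dep predT) //=.
rewrite -!big_split /=; apply: ler_sum => i _.
rewrite (bigID (fun j => close n (k' i) (l' j))) /= lerD2l.
rewrite (bigID (fun j => ~~ (k' i <= l' j + n)%N)) /= le_eqVlt; apply/orP; left; apply/eqP.
congr (_ + _).
  by apply: eq_bigl => j; rewrite not_close_lt.
by apply: eq_big => [j|j _]; [rewrite not_close_gt | rewrite [x i * y j]mulrC].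
Qed.

(** Positive and negative parts of [x] and [y] give four non-negative forms. The two mixed ones
    carry a minus sign, which is why the cut bound is imposed on the negative of [m] too. *)
Lemma signed_form_le (I J : finType) (m : I -> J -> R) (A B d : R) (n : nat)
    (x : I -> R) (y : J -> R) :
  0 < A -> 0 < B -> 0 <= d ->
  rows_bounded m A -> cols_bounded m B ->
  cut_bounded m d -> cut_bounded (fun i j => - m i j) d ->
  \sum_i x i ^+ 2 <= 1 -> \sum_j y j ^+ 2 <= 1 ->
  \sum_i \sum_j x i * y j * m i j
    <= 4 * (2 * Num.sqrt (A * B) / 2 ^+ n + 4 * d * (2 * n).+1%:R).
Proof.
move=> A0 B0 d0 hA hB hd hdN hx hy; set K := 2 * _ / _ + _.
have hAN : rows_bounded (fun i j => - m i j) A.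
  by move=> i; under eq_bigr do rewrite normrN; exact: hA.
have hBN : cols_bounded (fun i j => - m i j) B.
  by move=> i; under eq_bigr do rewrite normrN; exact: hB.
pose pos (t : R) := Num.max t 0.
have pos0 t : 0 <= pos t by rewrite le_max lexx orbT.
have posE t : t = pos t - pos (- t) by rewrite /pos; case: (lerP t 0); case: (lerP (- t) 0); lra.
have pos2 t : pos t ^+ 2 <= t ^+ 2.
  by rewrite /pos; case: (lerP t 0) => // _; rewrite expr0n sqr_ge0.
have posN2 t : pos (- t) ^+ 2 <= t ^+ 2 by rewrite -[X in _ <= X]sqrrN.
have le1 (K' : finType) (z z' : K' -> R) : (forall i, z' i ^+ 2 <= z i ^+ 2) ->
    \sum_i z i ^+ 2 <= 1 -> \sum_i z' i ^+ 2 <= 1.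
  by move=> h; apply: le_trans; apply: ler_sum => i _.
have xp := le1 _ x (fun i => pos (x i)) (fun i => pos2 (x i)) hx.
have xn := le1 _ x (fun i => pos (- x i)) (fun i => posN2 (x i)) hx.
have yp := le1 _ y (fun i => pos (y i)) (fun i => pos2 (y i)) hy.
have yn := le1 _ y (fun i => pos (- y i)) (fun i => posN2 (y i)) hy.
have p0 (K' : finType) (z : K' -> R) i : 0 <= pos (z i) by [].
have -> : 4 * K = (K + K) + (K + K) by ring.
have e1 := pos_form_le n A0 B0 d0 hA hB hd (p0 _ x) (p0 _ y) xp yp.
have e2 := pos_form_le n A0 B0 d0 hA hB hd (p0 _ (fun i => - x i)) (p0 _ (fun i => - y i)) xn yn.
have e3 := pos_form_le n A0 B0 d0 hAN hBN hdN (p0 _ x) (p0 _ (fun i => - y i)) xp yn.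
have e4 := pos_form_le n A0 B0 d0 hAN hBN hdN (p0 _ (fun i => - x i)) (p0 _ y) xn yp.
apply: le_trans (lerD (lerD e1 e2) (lerD e3 e4)).
rewrite -!big_split /=; apply: ler_sum => i _; rewrite -!big_split /=; apply: ler_sum => j _.
rewrite {1}(posE (x i)) {1}(posE (y j)) le_eqVlt; apply/orP; left; apply/eqP; ring.
Qed.

End RealFormBound.

(** * Singular values and trace duality *)

Section Cabs.
Variable R : realType.
Implicit Types z : R[i].
Local Open Scope complex_scope.

Definition cabs z : R := complex.Re `|z|.

Lemma cabsE z : `|z| = (cabs z)%:C.
Proof. by rewrite /cabs normc_def. Qed.

Lemma cabs_ge0 z : 0 <= cabs z.
Proof. by rewrite -ler0c -cabsE. Qed.

Lemma cabs0 : cabs 0 = 0.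
Proof. by apply: complexI; rewrite -cabsE normr0. Qed.

Lemma cabs1 : cabs 1 = 1.
Proof. by apply: complexI; rewrite -cabsE normr1. Qed.

Lemma cabs_eq0 z : (cabs z == 0) = (z == 0).
Proof. by rewrite -(inj_eq (@complexI R)) -cabsE normr_eq0. Qed.

Lemma cabsM z z' : cabs (z * z') = cabs z * cabs z'.
Proof. by apply: complexI; rewrite rmorphM /= -!cabsE normrM. Qed.

Lemma cabsD z z' : cabs (z + z') <= cabs z + cabs z'.
Proof. by rewrite -lecR rmorphD /= -!cabsE ler_normD. Qed.

Lemma cabsN z : cabs (- z) = cabs z.
Proof. by rewrite /cabs normrN. Qed.

Lemma cabs_conj z : cabs z^*%R = cabs z.
Proof. by apply: complexI; rewrite -!cabsE norm_conjC. Qed.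

Lemma cabs_sum (I : Type) (r : seq I) (P : pred I) (F : I -> R[i]) :
  cabs (\sum_(i <- r | P i) F i) <= \sum_(i <- r | P i) cabs (F i).
Proof.
elim/big_rec2: _ => [|i t z _ h]; first by rewrite cabs0.
by rewrite (le_trans (cabsD _ _)) // lerD2l.
Qed.

Lemma cabs_real (t : R) : cabs t%:C = `|t|.
Proof. by rewrite /cabs normc_def /= expr0n addr0 sqrtr_sqr. Qed.

Lemma conj_mul_cabs z : z^*%R * z = (cabs z ^+ 2)%:C.
Proof. by rewrite rmorphXn /= -cabsE normCK mulrC. Qed.

Lemma Re_le_cabs z : complex.Re z <= cabs z.
Proof. by rewrite (le_trans (ler_norm _)) // -lecR -cabsE normc_ge_Re. Qed.

Lemma ReD z z' : complex.Re (z + z') = complex.Re z + complex.Re z'.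
Proof. by case: z; case: z'. Qed.

Lemma Re_sum (I : Type) (r : seq I) (P : pred I) (F : I -> R[i]) :
  complex.Re (\sum_(i <- r | P i) F i) = \sum_(i <- r | P i) complex.Re (F i).
Proof. by elim/big_rec2: _ => // i t z _ <-; rewrite ReD. Qed.

Lemma Re_scale (t : R) z : complex.Re (t%:C * z) = t * complex.Re z.
Proof. by case: z => a b /=; rewrite mul0r subr0. Qed.

Lemma conj_realC (t : R) : (t%:C)^*%R = t%:C.
Proof. by apply/CrealP/complex_realP; exists t. Qed.

(** Turns the modulus of a pairing into the real part of a rotated pairing, on which real bilinear
    forms can act. *)
Lemma cabs_phase z : exists2 w, cabs w = 1 & complex.Re (w * z) = cabs z.
Proof.
have [->|z0] := eqVneq z 0; first by exists 1; rewrite ?cabs1 // mulr0 cabs0.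
exists (`|z| / z); last by rewrite divfK.
apply: complexI; rewrite -cabsE normrM normr_id normfV divff //.
by rewrite normr_eq0.
Qed.

End Cabs.

(** * Unitary diagonalisation, Schatten norms and duality estimates *)

Section Matrices.
Variables (R : realType) (N : nat).
Local Notation M := 'M[R[i]]_N.
Implicit Types A B U V W X Y Z P : M.
Local Open Scope complex_scope.
Local Open Scope sesquilinear_scope.

Lemma adjmxE A : adjmx A = A ^t*.
Proof. by apply/matrixP => i j; rewrite !mxE. Qed.

Lemma adjmxK A : adjmx (adjmx A) = A.
Proof. by rewrite !adjmxE trmxCK. Qed.

Lemma adjmxM A B : adjmx (A *m B) = adjmx B *m adjmx A.
Proof. by rewrite !adjmxE trmx_mul map_mxM. Qed.

Lemma adjmxD A B : adjmx (A + B) = adjmx A + adjmx B.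
Proof. by apply/matrixP => i j; rewrite !mxE rmorphD. Qed.

Lemma adjmxZ c A : adjmx (c *: A) = c^*%R *: adjmx A.
Proof. by apply/matrixP => i j; rewrite !mxE rmorphM. Qed.

Definition unitary U := adjmx U *m U = 1%:M.

Lemma unitaryV U : unitary U -> U *m adjmx U = 1%:M.
Proof. exact: mulmx1C. Qed.

Lemma unitary_adj U : unitary U -> unitary (adjmx U).
Proof. by move=> hU; rewrite /unitary adjmxK unitaryV. Qed.

Lemma unitaryM U V : unitary U -> unitary V -> unitary (U *m V).
Proof.
by move=> hU hV; rewrite /unitary adjmxM mulmxA -(mulmxA (adjmx V)) hU mulmx1.
Qed.

Lemma unitary_spectralmx A : unitary (spectralmx A).
Proof.
rewrite /unitary; apply: mulmx1C; rewrite adjmxE.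
exact/unitarymxP/spectral_unitarymx.
Qed.

Lemma gram_diag A k : (adjmx A *m A) k k = (\sum_l cabs (A l k) ^+ 2)%:C.
Proof.
by rewrite mxE rmorph_sum; apply: eq_bigr => l _; rewrite mxE conj_mul_cabs.
Qed.

(** The squared Frobenius norm, with no root taken. *)
Definition fro A : R := \sum_i \sum_j cabs (A i j) ^+ 2.

Lemma fro_ge0 A : 0 <= fro A.
Proof. by do 2!apply: sumr_ge0 => ? _; rewrite sqr_ge0. Qed.

Lemma hs_fro A : hs A A = (fro A)%:C.
Proof.
rewrite /hs /fro exchange_big rmorph_sum; apply: eq_bigr => k _.
exact: gram_diag.
Qed.

Lemma hermitian_spectral A : adjmx A = A ->
  A = adjmx (spectralmx A) *m diag_mx (spectral_diag A) *m spectralmx A.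
Proof.
move=> hA; have nA : A \is normalmx by apply/normalmxP; rewrite -adjmxE hA.
rewrite [adjmx (spectralmx A)]adjmxE -(invmx_unitary (spectral_unitarymx A)).
exact/orthomx_spectralP.
Qed.

Lemma hermitian_spectral_diag A : adjmx A = A ->
  spectralmx A *m A *m adjmx (spectralmx A) = diag_mx (spectral_diag A).
Proof.
move=> hA; rewrite {2}(hermitian_spectral hA).
have h := unitaryV (unitary_spectralmx A).
by rewrite !mulmxA h mul1mx -mulmxA h mulmx1.
Qed.

Lemma adjmx_gram A : adjmx (adjmx A *m A) = adjmx A *m A.
Proof. by rewrite adjmxM adjmxK. Qed.

(** Its columns are right singular vectors of [A], an orthonormal eigenbasis of [adjmx A *m A]. *)
Definition sing_basis A := adjmx (spectralmx (adjmx A *m A)).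

Lemma unitary_sing_basis A : unitary (sing_basis A).
Proof. exact/unitary_adj/unitary_spectralmx. Qed.

Lemma sing_basis_gram A : adjmx (A *m sing_basis A) *m (A *m sing_basis A) =
  diag_mx (spectral_diag (adjmx A *m A)).
Proof.
rewrite -(hermitian_spectral_diag (adjmx_gram A)) adjmxM adjmxK.
by rewrite !mulmxA.
Qed.

Lemma spectral_diag_gram A k : spectral_diag (adjmx A *m A) 0 k =
  (\sum_l cabs ((A *m sing_basis A) l k) ^+ 2)%:C.
Proof. by rewrite -gram_diag sing_basis_gram mxE eqxx mulr1n. Qed.

Lemma sqrtC_real (t : R) : 0 <= t -> sqrtC t%:C = (Num.sqrt t)%:C.
Proof.
move=> t0; apply/eqP; rewrite -(eqrXn2 (n := 2)) ?sqrtC_ge0 ?ler0c ?sqrtr_ge0 //.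
by rewrite sqrtCK -rmorphXn /= sqr_sqrtr.
Qed.

Lemma singvalE A k :
  singval A k = Num.sqrt (\sum_l cabs ((A *m sing_basis A) l k) ^+ 2).
Proof.
rewrite /singval spectral_diag_gram sqrtC_real //.
by apply: sumr_ge0 => l _; rewrite sqr_ge0.
Qed.

Lemma singval_ge0 A k : 0 <= singval A k.
Proof. by rewrite singvalE sqrtr_ge0. Qed.

Lemma sqr_singval A k : singval A k ^+ 2 = \sum_l cabs ((A *m sing_basis A) l k) ^+ 2.
Proof.
by rewrite singvalE sqr_sqrtr //; apply: sumr_ge0 => l _; rewrite sqr_ge0.
Qed.

Lemma gram_sing A :
  adjmx A *m A = sing_basis A *m diag_mx (\row_k (singval A k ^+ 2)%:C) *m adjmx (sing_basis A).
Proof.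
rewrite {1}(hermitian_spectral (adjmx_gram A)) /sing_basis adjmxK.
congr (_ *m diag_mx _ *m _); apply/rowP => k.
by rewrite spectral_diag_gram mxE sqr_singval.
Qed.

Lemma tr_conj_unitary U A : unitary U -> \tr (adjmx U *m A *m U) = \tr A.
Proof. by move=> hU; rewrite mxtrace_mulC mulmxA unitaryV // mul1mx. Qed.

Lemma sum_sqr_singval A : \sum_k singval A k ^+ 2 = fro A.
Proof.
apply: complexI; rewrite -hs_fro /hs gram_sing.
rewrite -{1}[sing_basis A]adjmxK tr_conj_unitary; last exact/unitary_adj/unitary_sing_basis.
by rewrite mxtrace_diag rmorph_sum; apply: eq_bigr => k _; rewrite mxE.
Qed.

Lemma schatten2E A : schatten2 A = Num.sqrt (fro A).
Proof. by rewrite /schatten2 sum_sqr_singval. Qed.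

Lemma schatten2_ge0 A : 0 <= schatten2 A.
Proof. exact: sqrtr_ge0. Qed.

Lemma sqr_schatten2 A : schatten2 A ^+ 2 = fro A.
Proof. by rewrite schatten2E sqr_sqrtr ?fro_ge0. Qed.

Lemma fro_eq0 A : fro A = 0 -> A = 0.
Proof.
move=> A0; apply/matrixP => i j; rewrite mxE.
have h1 i' : true -> 0 <= \sum_j' cabs (A i' j') ^+ 2.
  by move=> _; apply: sumr_ge0 => ? _; rewrite sqr_ge0.
have h2 j' : true -> 0 <= cabs (A i j') ^+ 2 by rewrite sqr_ge0.
have /(_ i isT) := psumr_eq0P h1 A0.
by move=> /(psumr_eq0P h2) /(_ j isT) /eqP; rewrite sqrf_eq0 cabs_eq0 => /eqP.
Qed.

Lemma schatten2_gt0 A : A != 0 -> 0 < schatten2 A.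
Proof.
move=> A0; rewrite schatten2E sqrtr_gt0 lt_def fro_ge0 andbT.
by apply: contra A0 => /eqP /fro_eq0 ->.
Qed.

Lemma singval_le_schatten2 A k : singval A k <= schatten2 A.
Proof.
rewrite -(ler_pXn2r (n := 2)) ?nnegrE ?singval_ge0 ?schatten2_ge0 //.
rewrite sqr_schatten2 -sum_sqr_singval (bigD1 k) //= lerDl.
by apply: sumr_ge0 => ? _; rewrite sqr_ge0.
Qed.

Lemma singval_le_schatten_inf A k : singval A k <= schatten_inf A.
Proof. exact: (le_bigmax_cond _ (singval A)). Qed.

Lemma schatten_inf_le A c : 0 <= c -> (forall k, singval A k <= c) -> schatten_inf A <= c.
Proof. by move=> c0 h; apply: bigmax_le. Qed.

Lemma schatten_inf_ge0 A : 0 <= schatten_inf A.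
Proof. exact: bigmax_ge_id. Qed.

Lemma schatten1_ge0 A : 0 <= schatten1 A.
Proof. by apply: sumr_ge0 => k _; exact: singval_ge0. Qed.

Lemma schatten_inf_le2 A : schatten_inf A <= schatten2 A.
Proof. by apply: schatten_inf_le; [exact: schatten2_ge0 | exact: singval_le_schatten2]. Qed.

Lemma schatten1_le2 A : schatten1 A <= N%:R * schatten2 A.
Proof.
rewrite -[N in N%:R]card_ord mulr_natl -sumr_const; apply: ler_sum => k _.
exact: singval_le_schatten2.
Qed.

Lemma schatten2_le1 A : schatten2 A <= schatten1 A.
Proof.
rewrite -(ler_pXn2r (n := 2)) ?nnegrE ?schatten1_ge0 ?schatten2_ge0 //.
rewrite sqr_schatten2 -sum_sqr_singval expr2 {1}/schatten1 mulr_suml.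
apply: ler_sum => k _; rewrite expr2 ler_wpM2l ?singval_ge0 //.
by rewrite /schatten1 (bigD1 k) //= lerDl sumr_ge0 // => ? _; exact: singval_ge0.
Qed.

Lemma schatten2_le_inf A : schatten2 A <= N%:R * schatten_inf A.
Proof.
apply: (le_trans (schatten2_le1 _)).
rewrite -[N in N%:R]card_ord mulr_natl -sumr_const; apply: ler_sum => k _.
exact: singval_le_schatten_inf.
Qed.

Lemma hs_cauchy_schwarz A B : cabs (hs A B) <= schatten2 A * schatten2 B.
Proof.
have -> : hs A B = \sum_(p : 'I_N * 'I_N) (A p.1 p.2)^*%R * B p.1 p.2.
  rewrite /hs /mxtrace; under eq_bigr do rewrite mxE.
  rewrite exchange_big pair_big /=; apply: eq_bigr => -[i j] _ /=.
  by rewrite mxE.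
apply: (le_trans (cabs_sum _ _ _)).
under eq_bigr do rewrite cabsM cabs_conj.
apply: (le_trans (sum_mul_le _ _)).
by rewrite !schatten2E /fro !pair_big.
Qed.

(* Computing the trace in the right singular basis of [Z], where the [k]th column
   of [Z] has length [singval Z k] while that of [W] has length one. *)
Lemma hs_unitary_le Z W : unitary W -> cabs (hs Z W) <= schatten1 Z.
Proof.
move=> hW; set C := sing_basis Z.
have hC : unitary C by exact: unitary_sing_basis.
have -> : hs Z W = \tr (adjmx (Z *m C) *m (W *m C)).
  by rewrite adjmxM mulmxA -(mulmxA (adjmx C)) tr_conj_unitary.
apply: (le_trans (cabs_sum _ _ _)); apply: ler_sum => k _; rewrite mxE.
apply: (le_trans (cabs_sum _ _ _)).
under eq_bigr do rewrite mxE cabsM cabs_conj.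
apply: (le_trans (sum_mul_le _ _)); rewrite -singvalE.
have -> : \sum_i cabs ((W *m C) i k) ^+ 2 = 1.
  by apply: complexI; rewrite -gram_diag (unitaryM hW hC) mxE eqxx.
by rewrite sqrtr1 mulr1.
Qed.

(** A diagonal entry is at most the length of its column. In the right singular basis of [Z] the
    squared length is an average of the squared singular values, with weights from a column of the
    unitary [W]. *)
Lemma conj_diag_le Z V j : unitary V -> cabs ((V *m Z *m adjmx V) j j) <= schatten_inf Z.
Proof.
move=> hV; have [C hC gC] : exists2 C, unitary C &
    adjmx Z *m Z = C *m diag_mx (\row_k (singval Z k ^+ 2)%:C) *m adjmx C.
  by exists (sing_basis Z); [exact: unitary_sing_basis | exact: gram_sing].
set E := V *m Z *m adjmx V.
set s := schatten_inf Z; have s0 : 0 <= s by exact: schatten_inf_ge0.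
rewrite -(ler_pXn2r (n := 2)) ?nnegrE ?cabs_ge0 //.
apply: (@le_trans _ _ (\sum_l cabs (E l j) ^+ 2)).
  by rewrite (bigD1 j) //= lerDl sumr_ge0 // => ? _; rewrite sqr_ge0.
set W := adjmx C *m adjmx V.
have hW : unitary W by apply: unitaryM; exact: unitary_adj.
have -> : \sum_l cabs (E l j) ^+ 2 = \sum_k singval Z k ^+ 2 * cabs (W k j) ^+ 2.
  apply: complexI; rewrite -gram_diag.
  have -> : adjmx E *m E = adjmx W *m (diag_mx (\row_k (singval Z k ^+ 2)%:C) *m W).
    rewrite /E /W !adjmxM !adjmxK.
    have -> : V *m (adjmx Z *m adjmx V) *m (V *m Z *m adjmx V) =
       V *m (adjmx Z *m (adjmx V *m V) *m Z) *m adjmx V by rewrite !mulmxA.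
    by rewrite hV mulmx1 gC !mulmxA.
  rewrite mxE rmorph_sum; apply: eq_bigr => k _.
  rewrite mul_diag_mx [adjmx W j k]mxE [X in _ * X]mxE [X in _ * (X * _)]mxE.
  by rewrite [in RHS]rmorphM /= -conj_mul_cabs mulrCA.
apply: (@le_trans _ _ (\sum_k s ^+ 2 * cabs (W k j) ^+ 2)).
  apply: ler_sum => k _; rewrite ler_wpM2r ?sqr_ge0 //.
  by rewrite ler_pXn2r ?nnegrE ?singval_ge0 //; exact: singval_le_schatten_inf.
rewrite -mulr_sumr.
have -> : \sum_k cabs (W k j) ^+ 2 = 1.
  by apply: complexI; rewrite -gram_diag hW mxE eqxx.
by rewrite mulr1.
Qed.

(** The diagonal matrix of squared singular values is unitarily conjugate to [adjmx P *m P = P],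
    hence idempotent, so every singular value is 0 or 1. *)
Lemma singval_idem P k : P *m P = P -> adjmx P = P -> singval P k = singval P k ^+ 2.
Proof.
move=> PP aP; have hC := unitary_sing_basis P; set C := sing_basis P in hC.
have PD : P = C *m diag_mx (\row_k (singval P k ^+ 2)%:C) *m adjmx C.
  by rewrite -gram_sing aP PP.
have DD : diag_mx (\row_k (singval P k ^+ 2)%:C) = adjmx C *m P *m C.
  by rewrite {2}PD !mulmxA hC mul1mx -mulmxA hC mulmx1.
set D := diag_mx _ in DD.
have : D *m D = D.
  rewrite DD; have -> : adjmx C *m P *m C *m (adjmx C *m P *m C) =
    adjmx C *m (P *m (C *m adjmx C) *m P) *m C by rewrite !mulmxA.
  by rewrite unitaryV // mulmx1 PP.
move=> /matrixP /(_ k k); rewrite mul_diag_mx !mxE eqxx mulr1n -rmorphM /=.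
move=> /complexI; have := singval_ge0 P k; set s := singval P k => s0 h.
have [->|s1] := eqVneq s 0; first by rewrite expr0n.
have s2 : s ^+ 2 = 1 by apply: (mulfI (expf_neq0 2 s1)); rewrite mulr1.
by rewrite s2; apply/eqP; rewrite -(eqrXn2 (n := 2)) // s2 expr1n.
Qed.

Lemma schatten1_proj P : P *m P = P -> adjmx P = P -> schatten1 P = fro P.
Proof.
move=> PP aP; rewrite -sum_sqr_singval; apply: eq_bigr => k _; exact: singval_idem.
Qed.

Lemma tr_proj P : P *m P = P -> adjmx P = P -> \tr P = (fro P)%:C.
Proof. by move=> PP aP; rewrite -hs_fro /hs aP PP. Qed.

Lemma schatten_inf_unitary W : unitary W -> schatten_inf W <= 1.
Proof.
move=> hW; apply: schatten_inf_le => // k.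
have := unitaryM hW (unitary_sing_basis W) => h.
rewrite singvalE; have -> : \sum_l cabs ((W *m sing_basis W) l k) ^+ 2 = 1.
  by apply: complexI; rewrite -gram_diag h mxE eqxx.
by rewrite sqrtr1.
Qed.

End Matrices.

(** * Operator norms and the kernel of a linear map *)

Section OperatorNorm.
Variables (R : realType) (N : nat) (T : {linear 'M[R[i]]_N -> 'M[R[i]]_N}).
Local Notation M := 'M[R[i]]_N.
Implicit Types X Y : M.
Local Open Scope complex_scope.

(** Makes the suprema behind the operator norms finite. [X] is expanded in matrix units, and each of
    its entries is at most its Frobenius norm. *)
Lemma linear_schatten2_bounded : exists2 K : R, 0 <= K &
  forall X, schatten2 (T X) <= K * schatten2 X.
Proof.
pose b k l := \sum_i \sum_j cabs (T (delta_mx i j) k l).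
have b0 k l : 0 <= b k l by do 2!apply: sumr_ge0 => ? _; exact: cabs_ge0.
pose K2 := \sum_k \sum_l b k l ^+ 2.
have K20 : 0 <= K2 by do 2!apply: sumr_ge0 => ? _; exact: sqr_ge0.
exists (Num.sqrt K2); first exact: sqrtr_ge0.
move=> X; rewrite !schatten2E -sqrtrM // ler_wsqrtr // /K2 mulr_suml.
apply: ler_sum => k _; rewrite mulr_suml; apply: ler_sum => l _.
rewrite -sqr_schatten2 -exprMn ler_pXn2r ?nnegrE ?cabs_ge0 ?mulr_ge0 ?schatten2_ge0 //.
rewrite {1}[X]matrix_sum_delta linear_sum summxE.
apply: (le_trans (cabs_sum _ _ _)); rewrite mulr_suml; apply: ler_sum => i _.
rewrite linear_sum summxE.
apply: (le_trans (cabs_sum _ _ _)); rewrite mulr_suml; apply: ler_sum => j _.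
rewrite linearZ mxE cabsM mulrC ler_wpM2l ?cabs_ge0 //.
rewrite -(ler_pXn2r (n := 2)) ?nnegrE ?cabs_ge0 ?schatten2_ge0 // sqr_schatten2.
rewrite /fro (bigD1 i) //= (bigD1 j) //= -addrA lerDl addr_ge0 //.
  by apply: sumr_ge0 => ? _; exact: sqr_ge0.
by do 2!apply: sumr_ge0 => ? _; exact: sqr_ge0.
Qed.

Section Equivalent.
(** Comparability with [schatten2] transfers boundedness, so one argument serves all three Schatten
    norms. *)
Variables (nrm : M -> R) (c : R).
Hypothesis c0 : 0 < c.
Hypotheses (nrm_le : forall X, nrm X <= c * schatten2 X).
Hypotheses (le_nrm : forall X, schatten2 X <= c * nrm X).

Lemma nrm_gt0 X : X != 0 -> 0 < nrm X.
Proof. by move=> /schatten2_gt0 h; have := lt_le_trans h (le_nrm X); rewrite pmulr_rgt0. Qed.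

Local Notation ratios := [set r : R | exists X : M, X != 0 /\ r = nrm (T X) / nrm X]%classic.

Lemma ratios_ubound : has_ubound ratios.
Proof.
have [K K0 hK] := linear_schatten2_bounded.
exists (c * (K * c)) => r [X [X0 ->]]; rewrite ler_pdivrMr ?nrm_gt0 //.
apply: (le_trans (nrm_le _)); rewrite -!mulrA ler_pM2l //.
by apply: (le_trans (hK _)); rewrite ler_wpM2l.
Qed.

Lemma opnorm_le X : X != 0 -> nrm (T X) <= opnorm nrm T * nrm X.
Proof.
move=> X0; rewrite -ler_pdivrMr ?nrm_gt0 //; apply: sup_ubound; first exact: ratios_ubound.
by exists X.
Qed.

Lemma opnorm_gt0 X : T X != 0 -> 0 < opnorm nrm T.
Proof.
move=> TX0; have X0 : X != 0 by apply: contraNneq TX0 => ->; rewrite linear0.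
have := lt_le_trans (nrm_gt0 TX0) (opnorm_le X0).
by rewrite pmulr_lgt0 // nrm_gt0.
Qed.

(** A maximiser up to a factor 2 comes directly from the definition of the supremum; the loss enters
    the 8 of [norm22_le_form]. *)
Lemma opnorm_half X0 : T X0 != 0 ->
  exists2 X, X != 0 & opnorm nrm T / 2 * nrm X <= nrm (T X).
Proof.
move=> TX0; have n0 := opnorm_gt0 TX0.
have X00 : X0 != 0 by apply: contraNneq TX0 => ->; rewrite linear0.
have hs : has_sup ratios by split; [exists (nrm (T X0) / nrm X0), X0 | exact: ratios_ubound].
have e0 : 0 < opnorm nrm T / 2 by rewrite divr_gt0.
have [r [X [X1 ->]] h] := sup_adherent e0 hs.
exists X => //; rewrite -ler_pdivlMr ?nrm_gt0 //; apply: ltW; apply: le_lt_trans h.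
rewrite -[sup _]/(opnorm nrm T); lra.
Qed.

End Equivalent.
End OperatorNorm.

Section Norms.
Variables (R : realType) (N : nat) (T : {linear 'M[R[i]]_N -> 'M[R[i]]_N}).
Implicit Types X Y : 'M[R[i]]_N.
Hypothesis N0 : (0 < N)%N.

Let Nr : 0 < N%:R :> R. Proof. by rewrite ltr0n. Qed.
Let N1 : 1 <= N%:R :> R. Proof. by rewrite ler1n. Qed.

Let schatten2_leN X : schatten2 X <= N%:R * schatten2 X.
Proof. by rewrite ler_peMl ?schatten2_ge0. Qed.

Let schatten2_leN1 X : schatten2 X <= N%:R * schatten1 X.
Proof. by rewrite (le_trans (schatten2_le1 X)) // ler_peMl ?schatten1_ge0. Qed.

Let schatten_inf_leN X : schatten_inf X <= N%:R * schatten2 X.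
Proof. by rewrite (le_trans (schatten_inf_le2 X)). Qed.

Lemma norm11_le X : X != 0 -> schatten1 (T X) <= norm11 T * schatten1 X.
Proof. exact: (opnorm_le T Nr (@schatten1_le2 _ _) schatten2_leN1). Qed.

Lemma norm22_le X : X != 0 -> schatten2 (T X) <= norm22 T * schatten2 X.
Proof. exact: (opnorm_le T Nr schatten2_leN schatten2_leN). Qed.

Lemma norminfinf_le X : X != 0 -> schatten_inf (T X) <= norminfinf T * schatten_inf X.
Proof. exact: (opnorm_le T Nr schatten_inf_leN (@schatten2_le_inf _ _)). Qed.

Lemma norm11_gt0 X : T X != 0 -> 0 < norm11 T.
Proof. exact: (opnorm_gt0 Nr (@schatten1_le2 _ _) schatten2_leN1). Qed.

Lemma norm22_gt0 X : T X != 0 -> 0 < norm22 T.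
Proof. exact: (opnorm_gt0 Nr schatten2_leN schatten2_leN). Qed.

Lemma norminfinf_gt0 X : T X != 0 -> 0 < norminfinf T.
Proof. exact: (opnorm_gt0 Nr schatten_inf_leN (@schatten2_le_inf _ _)). Qed.

Lemma norm22_half X0 : T X0 != 0 ->
  exists2 X, X != 0 & norm22 T / 2 * schatten2 X <= schatten2 (T X).
Proof. exact: (opnorm_half Nr schatten2_leN schatten2_leN). Qed.

End Norms.

(** * Hermitian matrices in a fixed unitary basis and the kernel of [T] *)

Section Forms.
Variables (R : realType) (N : nat).
Local Notation M := 'M[R[i]]_N.
Implicit Types (X Y U V P Q H : M) (x y : 'I_N -> R).
Local Open Scope complex_scope.

(** For unitary [U], the Hermitian matrix with eigenvalues [x] and the columns of [adjmx U] as
    eigenvectors; [delta i] gives a rank-one spectral projection and [indic S] the projection onto a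
    span of eigenvectors. *)
Definition rdiag U x : M := adjmx U *m diag_mx (\row_i (x i)%:C) *m U.

Definition delta (i : 'I_N) : 'I_N -> R := fun j => (j == i)%:R.

Definition indic (S : {set 'I_N}) : 'I_N -> R := fun j => (j \in S)%:R.

Lemma rdiag_sum U x : rdiag U x = \sum_i (x i)%:C *: rdiag U (delta i).
Proof.
rewrite /rdiag; under eq_bigr do rewrite scalemxAl scalemxAr.
rewrite -mulmx_suml -mulmx_sumr; congr (_ *m _ *m _).
apply/matrixP => i j; rewrite summxE (bigD1 i) //= big1 => [|k ki].
  by rewrite !mxE addr0 /delta eqxx mulrnAr mulr1.
by rewrite !mxE /delta (eq_sym i) (negbTE ki) mul0rn mulr0.
Qed.

Lemma rdiag_mul U x y : unitary U ->
  rdiag U x *m rdiag U y = rdiag U (fun i => x i * y i).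
Proof.
move=> hU; rewrite /rdiag.
set D := diag_mx _; set E := diag_mx _.
have -> : adjmx U *m D *m U *m (adjmx U *m E *m U) =
  adjmx U *m (D *m (U *m adjmx U) *m E) *m U by rewrite !mulmxA.
rewrite unitaryV // mulmx1 mulmx_diag; congr (_ *m diag_mx _ *m _).
by apply/rowP => i; rewrite !mxE rmorphM.
Qed.

Lemma adjmx_rdiag U x : adjmx (rdiag U x) = rdiag U x.
Proof.
rewrite /rdiag !adjmxM adjmxK mulmxA; congr (_ *m _ *m _).
apply/matrixP => i j; rewrite !mxE rmorphMn /= conj_realC.
by have [->|] := eqVneq i j; rewrite ?eqxx // eq_sym => /negbTE ->.
Qed.

Lemma tr_rdiag U x : unitary U -> \tr (rdiag U x) = (\sum_i x i)%:C.
Proof.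
move=> hU; rewrite tr_conj_unitary // mxtrace_diag rmorph_sum.
by apply: eq_bigr => i _; rewrite mxE.
Qed.

Lemma fro_rdiag U x : unitary U -> fro (rdiag U x) = \sum_i x i ^+ 2.
Proof.
move=> hU; apply: complexI; rewrite -hs_fro /hs adjmx_rdiag rdiag_mul // tr_rdiag //.
Qed.

Lemma rdiag_cst1 U : unitary U -> rdiag U (fun=> 1) = 1%:M.
Proof.
move=> hU; rewrite /rdiag (_ : diag_mx _ = 1%:M) ?mulmx1 //.
by apply/matrixP => i j; rewrite !mxE.
Qed.

Lemma unitary_rdiag U x : unitary U -> (forall i, x i ^+ 2 = 1) -> unitary (rdiag U x).
Proof.
move=> hU hx; rewrite /unitary adjmx_rdiag rdiag_mul // -(rdiag_cst1 hU).
by congr rdiag; apply/funext => i; rewrite -expr2 hx.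
Qed.

Lemma rdiag_idem U x : unitary U -> (forall i, x i * x i = x i) ->
  rdiag U x *m rdiag U x = rdiag U x.
Proof. by move=> hU hx; rewrite rdiag_mul //; congr rdiag; apply/funext. Qed.

Lemma nat_of_bool_idem (b : bool) : b%:R * b%:R = b%:R :> R.
Proof. by case: b; rewrite ?mulr1 ?mulr0. Qed.

Lemma sum_delta i : \sum_j delta i j = 1.
Proof. by rewrite (bigD1 i) //= big1 /delta ?eqxx ?addr0 // => j /negbTE ->. Qed.

Lemma sum_indic S : \sum_j indic S j = #|S|%:R.
Proof. by rewrite -natr_sum -big_mkcond /= sum1_card. Qed.

Lemma rdiag_neq0 U x : unitary U -> \sum_i x i != 0 -> rdiag U x != 0.
Proof.
move=> hU; apply: contraNneq => h; have /(congr1 (@complex.Re R)) := tr_rdiag x hU.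
by rewrite h mxtrace0 /= => <-.
Qed.

Lemma fro_rdiag_delta U i : unitary U -> fro (rdiag U (delta i)) = 1.
Proof.
by move=> hU; rewrite fro_rdiag // -[RHS](sum_delta i); apply: eq_bigr => j _;
  rewrite expr2 nat_of_bool_idem.
Qed.

Lemma hermitian_rdiag H : adjmx H = H ->
  exists U x, unitary U /\ H = rdiag U x.
Proof.
move=> hH; exists (spectralmx H), (fun i => complex.Re (spectral_diag H 0 i)).
have hU := unitary_spectralmx H; split=> //.
rewrite {1}(hermitian_spectral hH) /rdiag; congr (_ *m diag_mx _ *m _).
apply/rowP => i; rewrite mxE RRe_real //; apply/CrealP.
(* The eigenvalues are real because the diagonal matrix is a unitary conjugate of [H], hence
   self-adjoint. *)
have : adjmx (diag_mx (spectral_diag H)) = diag_mx (spectral_diag H).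
  by rewrite -hermitian_spectral_diag // !adjmxM adjmxK hH mulmxA.
by move=> /matrixP /(_ i i); rewrite !mxE eqxx !mulr1n.
Qed.

Lemma hs_sumr A (I : finType) (c : I -> R) (B : I -> M) :
  hs A (\sum_i (c i)%:C *: B i) = \sum_i (c i)%:C * hs A (B i).
Proof.
rewrite /hs mulmx_sumr raddf_sum; apply: eq_bigr => i _.
by rewrite -scalemxAr /= mxtraceZ.
Qed.

Lemma hs_conj X Y : hs X Y = (hs Y X)^*%R.
Proof.
have YX : adjmx Y *m X = adjmx (adjmx X *m Y) by rewrite adjmxM adjmxK.
rewrite /hs YX /mxtrace rmorph_sum; apply: eq_bigr => i _.
by rewrite /= [in RHS]mxE conjCK.
Qed.

Lemma hs_suml B (I : finType) (c : I -> R) (A : I -> M) :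
  hs (\sum_i (c i)%:C *: A i) B = \sum_i (c i)%:C * hs (A i) B.
Proof.
rewrite hs_conj hs_sumr rmorph_sum; apply: eq_bigr => i _.
by rewrite rmorphM /= conj_realC -hs_conj.
Qed.

Variable T : {linear M -> M}.

(** The matrix [m_ij] of pairings, rotated by [w] before the real part is taken. *)
Definition pkernel (w : R[i]) U V (i j : 'I_N) : R :=
  complex.Re (w * hs (T (rdiag U (delta i))) (rdiag V (delta j))).

Lemma kernel_form w U V x y : \sum_i \sum_j x i * y j * pkernel w U V i j =
  complex.Re (w * hs (T (rdiag U x)) (rdiag V y)).
Proof.
rewrite [rdiag U x]rdiag_sum [rdiag V y]rdiag_sum linear_sum /=.
under [X in hs X _]eq_bigr do rewrite linearZ /=.
rewrite hs_suml mulr_sumr Re_sum; apply: eq_bigr => i _.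
rewrite hs_sumr !mulr_sumr Re_sum; apply: eq_bigr => j _.
rewrite /pkernel -mulrA -!Re_scale; congr complex.Re; ring.
Qed.

Hypothesis N0 : (0 < N)%N.
Variables (w : R[i]) (U V : M).
Hypotheses (w1 : cabs w = 1) (hU : unitary U) (hV : unitary V).

Lemma kernel_form_le x y : \sum_i \sum_j x i * y j * pkernel w U V i j <=
  cabs (hs (T (rdiag U x)) (rdiag V y)).
Proof. by rewrite kernel_form (le_trans (Re_le_cabs _)) // cabsM w1 mul1r. Qed.

(** The value at 0 is 1, so that a diagonal of signs is always unitary. *)
Definition sign1 (t : R) : R := if 0 <= t then 1 else -1.

Lemma sign1_mul t : sign1 t * t = `|t|.
Proof.
rewrite /sign1; case: (lerP 0 t) => [/ger0_norm|/ltr0_norm] ->.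
  by rewrite mul1r.
by rewrite mulN1r.
Qed.

Lemma sign1_sqr t : sign1 t ^+ 2 = 1.
Proof. by rewrite /sign1; case: ifP; rewrite ?sqrrN expr1n. Qed.

(** With signs matched to row [i], the absolute row sum is a pairing of [T p_i] with a unitary,
    hence at most the trace norm of [T p_i]; and [p_i] has trace norm 1. *)
Lemma kernel_rows : norm11 T >= 0 -> rows_bounded (pkernel w U V) (norm11 T).
Proof.
move=> T0 i; pose b j := sign1 (pkernel w U V i j).
have -> : \sum_j `|pkernel w U V i j| =
    \sum_i' \sum_j delta i i' * b j * pkernel w U V i' j.
  rewrite [RHS](bigD1 i) //= [X in _ + X]big1 ?addr0.
    by apply: eq_bigr => j _; rewrite /delta eqxx mul1r sign1_mul.
  by move=> i' /negbTE ii; apply: big1 => j _; rewrite /delta ii !mul0r.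
apply: (le_trans (kernel_form_le _ _)).
have hW : unitary (rdiag V b) by apply: unitary_rdiag => // j; exact: sign1_sqr.
apply: (le_trans (hs_unitary_le _ hW)).
have P0 : rdiag U (delta i) != 0 by rewrite rdiag_neq0 // sum_delta oner_eq0.
rewrite (le_trans (norm11_le T N0 P0)) // schatten1_proj ?adjmx_rdiag //.
  by rewrite fro_rdiag_delta // mulr1.
by apply: rdiag_idem => // j; exact: nat_of_bool_idem.
Qed.

Lemma hs_rdiag_delta Z j : hs Z (rdiag V (delta j)) = ((V *m Z *m adjmx V) j j)^*%R.
Proof.
have -> : ((V *m Z *m adjmx V) j j)^*%R = (V *m adjmx Z *m adjmx V) j j.
  rewrite -[RHS]/((V *m adjmx Z *m adjmx V) j j) -[V in V *m adjmx Z]adjmxK -mulmxA.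
  by rewrite -!adjmxM [in RHS]mxE !mulmxA.
rewrite /hs /rdiag mulmxA mxtrace_mulC !mulmxA.
rewrite mul_mx_diag /mxtrace (bigD1 j) //= big1 ?addr0 => [|k kj].
  by rewrite mxE mxE /delta eqxx mulr1.
by rewrite mxE mxE /delta (negbTE kj) mulr0.
Qed.

(** Dual to [kernel_rows]: the signs form a unitary argument of [T], of operator norm at most 1, and
    pairing with [q_j] reads off a diagonal entry. *)
Lemma kernel_cols : norminfinf T >= 0 -> cols_bounded (pkernel w U V) (norminfinf T).
Proof.
move=> T0 j; pose a i := sign1 (pkernel w U V i j).
have -> : \sum_i `|pkernel w U V i j| =
    \sum_i \sum_j' a i * delta j j' * pkernel w U V i j'.
  apply: eq_bigr => i _; rewrite [RHS](bigD1 j) //= [X in _ + X]big1 ?addr0.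
    by rewrite /delta eqxx mulr1 sign1_mul.
  by move=> j' /negbTE jj; rewrite /delta jj mulr0 mul0r.
apply: (le_trans (kernel_form_le _ _)).
have hW : unitary (rdiag U a) by apply: unitary_rdiag => // i; exact: sign1_sqr.
rewrite hs_rdiag_delta cabs_conj.
apply: (le_trans (conj_diag_le _ _ hV)).
have W0 : rdiag U a != 0.
  apply: contraNneq (oner_neq0 R[i]) => h; have := hW.
  rewrite /unitary h mulmx0 => /matrixP /(_ (Ordinal N0) (Ordinal N0)).
  by rewrite !mxE eqxx => /esym/eqP.
apply: (le_trans (norminfinf_le T N0 W0)).
by rewrite ler_piMr // schatten_inf_unitary.
Qed.

Lemma kernel_cut (d : R) : 0 <= d ->
  (forall P Q, nz_orth_proj P -> nz_orth_proj Q ->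
    cabs (hs (T P) Q) <= d * Num.sqrt (complex.Re (\tr P) * complex.Re (\tr Q))) ->
  cut_bounded (pkernel w U V) d.
Proof.
move=> d0 h S S'.
have -> : \sum_(i in S) \sum_(j in S') pkernel w U V i j =
    \sum_i \sum_j indic S i * indic S' j * pkernel w U V i j.
  rewrite big_mkcond; apply: eq_bigr => i _; rewrite /indic.
  case: (i \in S); last by rewrite big1 // => j _; rewrite !mul0r.
  rewrite big_mkcond; apply: eq_bigr => j _.
  by case: (j \in S'); rewrite !(mul1r, mul0r).
(* Empty sets are treated apart: they give the zero projection, to which [h] does not apply. *)
have [->|S0] := eqVneq S finset.set0.
  rewrite big1 ?mulr_ge0 ?sqrtr_ge0 // => i _.
  by apply: big1 => j _; rewrite /indic inE !mul0r.
have [->|S0'] := eqVneq S' finset.set0.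
  rewrite big1 ?mulr_ge0 ?sqrtr_ge0 // => i _.
  by apply: big1 => j _; rewrite /indic inE mulr0 mul0r.
have proj W (A : {set 'I_N}) : unitary W -> A != finset.set0 -> nz_orth_proj (rdiag W (indic A)).
  move=> hW A0; split; [|exact: adjmx_rdiag|].
    by apply: rdiag_idem => // i; exact: nat_of_bool_idem.
  by rewrite rdiag_neq0 // sum_indic pnatr_eq0 cards_eq0.
apply: (le_trans (kernel_form_le _ _)); apply: (le_trans (h _ _ _ _)); try exact: proj.
by rewrite !tr_rdiag // !sum_indic.
Qed.

End Forms.

(** * Reduction to projections *)

Section Reduction.
Variables (R : realType) (N : nat) (T : {linear 'M[R[i]]_N -> 'M[R[i]]_N}).
Local Notation M := 'M[R[i]]_N.
Implicit Types X Y H : M.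
Hypothesis N0 : (0 < N)%N.
Local Open Scope complex_scope.

Lemma froZ (c : R[i]) X : fro (c *: X) = cabs c ^+ 2 * fro X.
Proof.
rewrite /fro mulr_sumr; apply: eq_bigr => i _; rewrite mulr_sumr; apply: eq_bigr => j _.
by rewrite mxE cabsM exprMn.
Qed.

Lemma schatten2_adj X : schatten2 (adjmx X) = schatten2 X.
Proof.
rewrite !schatten2E /fro exchange_big /=; congr Num.sqrt.
by do 2!apply: eq_bigr => ? _; rewrite mxE cabs_conj.
Qed.

Lemma schatten2_le1E X : (schatten2 X <= 1) = (fro X <= 1).
Proof. by rewrite -sqr_schatten2 expr_le1 ?schatten2_ge0. Qed.

Lemma fro_average X Y : fro X <= 1 -> fro Y <= 1 -> fro ((1 / 2)%:C *: (X + Y)) <= 1.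
Proof.
have p2 (a b : R) : ((a + b) / 2) ^+ 2 <= (a ^+ 2 + b ^+ 2) / 2.
  by rewrite -subr_ge0 (_ : _ - _ = ((a - b) / 2) ^+ 2) ?sqr_ge0 //; field.
move=> hX hY; apply: (@le_trans _ _ ((fro X + fro Y) / 2)); last lra.
rewrite /fro -big_split mulr_suml; apply: ler_sum => i _ /=.
rewrite -big_split mulr_suml; apply: ler_sum => j _ /=.
rewrite !mxE cabsM cabs_real gtr0_norm; last lra.
have [x0 y0] := (cabs_ge0 (X i j), cabs_ge0 (Y i j)).
have [z0 xy] := (cabs_ge0 (X i j + Y i j), cabsD (X i j) (Y i j)).
by apply: le_trans (p2 _ _); rewrite ler_pXn2r // ?nnegrE; lra.
Qed.

Lemma cartesian X : fro X <= 1 -> exists H1 H2,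
  [/\ adjmx H1 = H1, adjmx H2 = H2, fro H1 <= 1, fro H2 <= 1 & X = H1 + 'i *: H2].
Proof.
move=> hX; have haX : fro (adjmx X) <= 1 by rewrite -schatten2_le1E schatten2_adj schatten2_le1E.
have cabsi : cabs ('i : R[i]) = 1 by rewrite /cabs normc_def /= expr0n add0r expr1n sqrtr1.
have ii : 'i * 'i = -1 :> R[i] by rewrite -expr2 sqr_i.
have coni : ('i%C : R[i])^*%R = - 'i by rewrite complexiE conjCi.
(* The second witness is [(X - adjmx X) / (2 'i)], written as an average of two elements of the unit
   ball so that [fro_average] applies. *)
exists ((1 / 2)%:C *: (X + adjmx X)), ((1 / 2)%:C *: ((- 'i) *: X + 'i *: adjmx X)); split.
- by rewrite adjmxZ conj_realC adjmxD adjmxK addrC.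
- by rewrite adjmxZ conj_realC adjmxD !adjmxZ rmorphN /= coni opprK adjmxK addrC.
- exact: fro_average.
- by apply: fro_average; rewrite froZ ?cabsN cabsi expr1n mul1r.
have h2 : (1 / 2 : R)%:C * 2 = 1.
  by rewrite -(rmorph_nat (real_complex R) 2) -rmorphM /= divfK ?pnatr_eq0.
have key (h x z : R[i]) : h * 2 = 1 -> x = h * (x + z) + 'i * (h * (- 'i * x + 'i * z)).
  move=> hh; transitivity (h * (x + z) - ('i * 'i) * (h * (x - z))); last by ring.
  by rewrite ii; transitivity (h * 2 * x); [rewrite hh mul1r | ring].
by apply/matrixP => k l; rewrite !mxE; exact: key.
Qed.

Lemma hsDl X X' Y : hs (X + X') Y = hs X Y + hs X' Y.
Proof. by rewrite /hs adjmxD mulmxDl raddfD. Qed.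

Lemma hsDr X Y Y' : hs X (Y + Y') = hs X Y + hs X Y'.
Proof. by rewrite /hs mulmxDr raddfD. Qed.

Lemma hsZr c X Y : hs X (c *: Y) = c * hs X Y.
Proof. by rewrite /hs -scalemxAr mxtraceZ. Qed.

Lemma hsZl c X Y : hs (c *: X) Y = c^*%R * hs X Y.
Proof. by rewrite /hs adjmxZ -scalemxAl mxtraceZ. Qed.

(** [K] stays abstract because it is instantiated twice: by the Schur test in [height_ge] and by the
    dyadic bound in [norm22_le_cut]. *)
Variable K : R.
Hypothesis kernel_le : forall w U V x y,
  cabs w = 1 -> unitary U -> unitary V ->
  \sum_i x i ^+ 2 <= 1 -> \sum_j y j ^+ 2 <= 1 ->
  \sum_i \sum_j x i * y j * pkernel T w U V i j <= K.

Lemma hermitian_form_le H1 H2 : adjmx H1 = H1 -> adjmx H2 = H2 ->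
  fro H1 <= 1 -> fro H2 <= 1 -> cabs (hs (T H1) H2) <= K.
Proof.
move=> /hermitian_rdiag[U [x [hU ->]]] /hermitian_rdiag[V [y [hV ->]]].
rewrite !fro_rdiag // => hx hy.
have [w w1 <-] := cabs_phase (hs (T (rdiag U x)) (rdiag V y)).
by rewrite -kernel_form kernel_le.
Qed.

Lemma form_le X Y : fro X <= 1 -> fro Y <= 1 -> cabs (hs (T X) Y) <= 4 * K.
Proof.
move=> /cartesian[H1 [H2 [a1 a2 f1 f2 ->]]] /cartesian[G1 [G2 [b1 b2 g1 g2 ->]]].
have cabsi : cabs ('i : R[i]) = 1 by rewrite /cabs normc_def /= expr0n add0r expr1n sqrtr1.
rewrite linearD linearZ /= hsDl !hsDr !hsZl !hsZr.
have -> : 4 * K = (K + K) + (K + K) by ring.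
apply: (le_trans (cabsD _ _)); apply: lerD; apply: (le_trans (cabsD _ _)); apply: lerD;
  by rewrite ?cabsM ?cabs_conj ?cabsi ?mul1r hermitian_form_le.
Qed.

(** Pairing the normalised [T X] with the image of the normalised [X] gives
    [schatten2 (T X) / schatten2 X]. The 8 is the 4 of [form_le] times the 2 lost in
    [norm22_half]. *)
Lemma norm22_le_form X0 : T X0 != 0 -> norm22 T <= 8 * K.
Proof.
move=> /(norm22_half N0)[X X1 hX].
(* If [T X] vanishes then [norm22 T <= 0], while the form at zero shows [0 <= 4 * K]. *)
have [TX|TX] := eqVneq (T X) 0.
  have s0 : schatten2 (0 : M) = 0.
    rewrite schatten2E (_ : fro 0 = 0) ?sqrtr0 //.
    by rewrite /fro big1 // => i _; rewrite big1 // => j _; rewrite mxE cabs0 expr0n.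
  have f0 : fro (0 : M) <= 1 by rewrite -schatten2_le1E s0.
  have := form_le f0 f0; rewrite linear0 /hs mulmx0 mxtrace0 cabs0 => K0.
  move: hX; rewrite TX s0 pmulr_lle0 ?schatten2_gt0 //; lra.
set a := schatten2 X; set b := schatten2 (T X).
have a0 : 0 < a by exact: schatten2_gt0.
have b0 : 0 < b by exact: schatten2_gt0.
have unit (Z : M) : Z != 0 -> fro (((schatten2 Z)^-1)%:C *: Z) <= 1.
  move=> /schatten2_gt0 z0; rewrite froZ cabs_real -sqr_schatten2 -exprMn.
  by rewrite gtr0_norm ?invr_gt0 // mulVf ?expr1n // gt_eqF.
have := form_le (unit _ X1) (unit _ TX).
rewrite linearZ /= hsZl hsZr conj_realC !cabsM !cabs_real hs_fro cabs_real -/a -/b.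
rewrite -sqr_schatten2 -/b !gtr0_norm ?invr_gt0 ?exprn_gt0 //.
have -> : a^-1 * (b^-1 * b ^+ 2) = b / a by field; rewrite ?gt_eqF.
move=> h; have : norm22 T / 2 <= b / a by rewrite ler_pdivlMr.
lra.
Qed.

End Reduction.

(** * Height, cut bound and final constants *)

Section Main.
Variables (R : realType) (N : nat) (T : {linear 'M[R[i]]_N -> 'M[R[i]]_N}).
Implicit Types X Y P Q : 'M[R[i]]_N.
Hypothesis N0 : (0 < N)%N.
Variable X0 : 'M[R[i]]_N.
Hypothesis TX0 : T X0 != 0.

Let A0 := norm11_gt0 N0 TX0.
Let B0 := norminfinf_gt0 N0 TX0.
Let C0 := norm22_gt0 N0 TX0.

Lemma sqrt_norms : Num.sqrt (norm11 T * norminfinf T) = height T * norm22 T.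
Proof. by rewrite /height divfK // gt_eqF. Qed.

(** Keeps [ln (height T + 1)] away from 0, so that additive constants can be absorbed into it. *)
Lemma height_ge : 8^-1 <= height T.
Proof.
rewrite /height ler_pdivlMr //.
have : norm22 T <= 8 * Num.sqrt (norm11 T * norminfinf T).
  apply: (norm22_le_form N0 _ TX0) => w U V x y w1 hU hV hx hy.
  apply: schur_test => //; [exact: kernel_rows (ltW A0) | exact: kernel_cols (ltW B0)].
lra.
Qed.

Lemma norm22_le_cut (d : R) n : 0 <= d ->
  (forall P Q, nz_orth_proj P -> nz_orth_proj Q ->
    cabs (hs (T P) Q) <= d * Num.sqrt (complex.Re (\tr P) * complex.Re (\tr Q))) ->
  norm22 T <= 64 * (height T / 2 ^+ n) * norm22 T + 128 * d * (2 * n).+1%:R.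
Proof.
(* The constants are [64 = 8 * 4 * 2] and [128 = 8 * 4 * 4]: the 8 of [norm22_le_form], the four
   sign patterns, and the coefficients of [pos_form_le]. *)
move=> d0 hd; have := @norm22_le_form _ _ T N0
  (4 * (2 * Num.sqrt (norm11 T * norminfinf T) / 2 ^+ n + 4 * d * (2 * n).+1%:R)) _ _ TX0.
rewrite sqrt_norms => h.
rewrite (le_trans (h _)) => [//|w U V x y w1 hU hV hx hy|]; last first.
  by rewrite le_eqVlt; apply/orP; left; apply/eqP; ring.
rewrite -sqrt_norms.
apply: signed_form_le => //; [exact: kernel_rows (ltW A0) | exact: kernel_cols (ltW B0) |
  exact: kernel_cut |].
(* The phase [- w] negates the kernel, so [kernel_cut] also gives the cut bound for the negative. *)
have wN : cabs (- w) = 1 by rewrite cabsN.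
move=> S S'; apply: le_trans (kernel_cut wN hU hV d0 hd S S').
apply: ler_sum => i _; apply: ler_sum => j _; rewrite /pkernel mulNr.
by case: (w * _).
Qed.

Lemma hs_proj_le P Q : nz_orth_proj P -> nz_orth_proj Q ->
  cabs (hs (T P) Q) <= norm22 T * Num.sqrt (complex.Re (\tr P) * complex.Re (\tr Q)).
Proof.
move=> [PP aP P0] [QQ aQ Q0]; apply: (le_trans (hs_cauchy_schwarz _ _)).
rewrite !tr_proj //= sqrtrM ?fro_ge0 // -!schatten2E mulrA.
by rewrite ler_wpM2r ?schatten2_ge0 // norm22_le.
Qed.

Lemma proj_weight_gt0 P Q : nz_orth_proj P -> nz_orth_proj Q ->
  0 < Num.sqrt (complex.Re (\tr P) * complex.Re (\tr Q)).
Proof.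
move=> [PP aP P0] [QQ aQ Q0].
by rewrite !tr_proj //= sqrtrM ?fro_ge0 // -!schatten2E mulr_gt0 ?schatten2_gt0.
Qed.

End Main.

Lemma ln2_gt0 (R : realType) : 0 < ln (2 : R).
Proof. by rewrite ln_gt0 // ltr1n. Qed.

(** Logarithms give [n <= 8 + ln (h + 1) / ln 2], so the count is at most 17 plus a multiple of
    [ln (h + 1)]; the 17 is absorbed because [h + 1 >= 9 / 8]. *)
Lemma level_count_le (R : realType) (h : R) (n : nat) : 8^-1 <= h -> 2 ^+ n <= 256 * h ->
  (2 * n).+1%:R <= (17 / ln (9 / 8) + 2 / ln 2) * ln (h + 1).
Proof.
move=> h8 hn; have l2 := ln2_gt0 R.
have l98 : 0 < ln (9 / 8 : R) by rewrite ln_gt0 //; lra.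
have h1 : ln (9 / 8) <= ln (h + 1) by rewrite ler_ln ?posrE; lra.
have nl : n%:R * ln 2 <= 8 * ln 2 + ln (h + 1).
  have -> : n%:R * ln 2 = ln (2 ^+ n : R) by rewrite lnXn // mulr_natl.
  have -> : 8 * ln 2 + ln (h + 1) = ln (2 ^+ 8 * (h + 1)).
    by rewrite lnM ?posrE ?exprn_gt0 // ?lnXn ?mulr_natl //; lra.
  by rewrite ler_ln ?posrE ?mulr_gt0 ?exprn_gt0 //; lra.
have n8 : n%:R <= 8 + ln (h + 1) / ln 2.
  by rewrite -(ler_pM2r l2) mulrDl divfK // gt_eqF.
have e17 : 17 <= 17 / ln (9 / 8) * ln (h + 1).
  by rewrite mulrAC ler_pdivlMr // ler_wpM2l.
have -> : (2 * n).+1%:R = 2 * n%:R + 1 :> R by rewrite -natr1 natrM.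
have -> : (17 / ln (9 / 8) + 2 / ln 2) * ln (h + 1) =
  17 / ln (9 / 8) * ln (h + 1) + 2 * (ln (h + 1) / ln 2)
  by rewrite mulrDl -[2 / _ * _]mulrA [_^-1 * ln (h + 1)]mulrC.
lra.
Qed.

Theorem theorem4p2 (R : realType) :
  exists C : R, 1 < C /\
  forall (N : nat), (1 <= N)%N ->
  forall T : {linear 'M[R[i]]_N -> 'M[R[i]]_N},
    (exists X : 'M[R[i]]_N, T X != 0) ->
    exists P Q : 'M[R[i]]_N,
      [/\ nz_orth_proj P, nz_orth_proj Q,
          norm22 T / (C * ln (height T + 1)) <
            complex.Re `|hs (T P) Q| / Num.sqrt (complex.Re (\tr P) * complex.Re (\tr Q))
        & complex.Re `|hs (T P) Q| / Num.sqrt (complex.Re (\tr P) * complex.Re (\tr Q))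
            <= norm22 T].
Proof.
pose c : R := 17 / ln (9 / 8) + 2 / ln 2.
have c0 : 0 < c by rewrite addr_gt0 // divr_gt0 ?ln2_gt0 // ln_gt0 //; lra.
(* The 1 gives [1 < C]; 512 exceeds the 256 left after half of [norm22 T] is absorbed. *)
have [C C1 CE] : exists2 C : R, 1 < C & C = 1 + 512 * c by exists (1 + 512 * c); lra.
exists C; split=> //.
move=> N N0 T [X0 TX0].
have C0 := norm22_gt0 N0 TX0; have h8 := height_ge N0 TX0.
set h := height T in h8 *.
have lh : 0 < ln (h + 1) by rewrite ln_gt0 //; lra.
have e0 : 0 < C * ln (h + 1) by rewrite mulr_gt0 // (lt_trans ltr01).
pose d := norm22 T / (C * ln (h + 1)).
have d0 : 0 < d by rewrite divr_gt0.
(* The upper inequality always holds, so if no pair works, every pair fails the lower one, and [d]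
   bounds all normalised pairings. *)
apply: contrapT => noPQ.
have hd P Q : nz_orth_proj P -> nz_orth_proj Q ->
    cabs (hs (T P) Q) <= d * Num.sqrt (complex.Re (\tr P) * complex.Re (\tr Q)).
  move=> hP hQ; rewrite -ler_pdivrMr ?proj_weight_gt0 // leNgt; apply/negP => lt.
  apply: noPQ; exists P, Q; split=> //.
  by rewrite ler_pdivrMr ?proj_weight_gt0 // hs_proj_le.
(* Such a [k] exists because [128 * h >= 16]. Taking [n = k.+1] makes [64 * (h / 2 ^+ n)] at most
   one half while [2 ^+ n <= 256 * h]. *)
have [k /andP[hk1 hk2]] : exists k : nat, 1 * 2 ^+ k <= 128 * h < 1 * 2 ^+ k.+1.
  by apply: dyadic_level => //; lra.
have n256 : 2 ^+ k.+1 <= 256 * h by rewrite exprS; lra.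
have cnt := level_count_le h8 n256; rewrite -/c in cnt.
have := norm22_le_cut N0 TX0 k.+1 (ltW d0) hd; rewrite -/h.
have p0 : 0 < 2 ^+ k.+1 :> R by rewrite exprn_gt0.
have half : h / 2 ^+ k.+1 <= 128^-1 by rewrite ler_pdivrMr //; lra.
have e1 : 64 * (h / 2 ^+ k.+1) * norm22 T <= 1 / 2 * norm22 T.
  by rewrite (ler_wpM2r (ltW C0)) //; lra.
have e2 : 128 * d * (2 * k.+1).+1%:R <= 128 * d * (c * ln (h + 1)).
  by rewrite ler_wpM2l // mulr_ge0 // ltW.
have e3 : d * (C * ln (h + 1)) = norm22 T by rewrite divfK // gt_eqF.
have e4 : 0 < d * ln (h + 1) by rewrite mulr_gt0.
move=> fin; have : norm22 T = d * ln (h + 1) + 512 * (d * (c * ln (h + 1))).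
  by rewrite -e3 CE; ring.
by lra.
Qed.
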